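(* Let $P$ be a directed set equipped with a second-countable topology in which every convergent sequence is bounded. If a topological space $X$ has a neighborhood $P$-base at a point $x\in X$, then $X$ has a countable Pytkeev$^\ast$-network at $x$.
   Context: All topological spaces are assumed to be Tychonoff. A poset is directed if any two elements have a common upper bound. ''Every convergent sequence is bounded'' means that whenever a sequence in $P$ converges in the given topology, the set of its terms has an upper bound in $P$. A subset $C$ of a poset $P$ is cofinal if for every $p\in P$ there is $q\in C$ with $p\leq q$. For directed sets $P,Q$, $Q$ is a Tukey quotient of $P$ if there is a map $\phi:P\to Q$ carrying cofinal subsets of $P$ to cofinal subsets of $Q$. A space $X$ has a neighborhood $P$-base at $x\in X$ if the poset of neighborhoods of $x$, ordered by reverse inclusion, is a Tukey quotient of $P$ (equivalently, there is a neighborhood base $\{U_p:p\in P\}$ at $x$ with $U_q\subseteq U_p$ whenever $p\leq q$). A sequence $\{x_n:n\in\omega\}$ accumulates at $x$ if every neighborhood of $x$ contains $x_n$ for infinitely many $n$. A family $\mathcal{N}$ of subsets of $X$ is a Pytkeev$^\ast$-network at $x$ if for any neighborhood $O_x$ of $x$ and any sequence $\{x_n:n\in\omega\}$ in $X$ that accumulates at $x$ there exists $N\in\mathcal{N}$ such that $N\subseteq O_x$ and the set $\{n\in\omega:x_n\in N\}$ is infinite. *)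

(* Defs.v *)
From HB Require Import structures.
From mathcomp Require Import all_boot all_order.
From mathcomp Require Import all_classical all_reals all_analysis.

Set Implicit Arguments.
Unset Strict Implicit.
Unset Printing Implicit Defensive.

Local Open Scope classical_set_scope.

(* [completely_regular_space] does not include any separation axiom. *)
Definition tychonoff_space (T : topologicalType) : Prop :=
  accessible_space T /\ completely_regular_space T.

Definition directed {d : Order.disp_t} (P : porderType d) : Prop :=
  forall p q : P, exists r : P, (p <= r)%O /\ (q <= r)%O.

Definition cofinal {d : Order.disp_t} {P : porderType d} (C : set P) : Prop :=
  forall p : P, exists2 q : P, C q & (p <= q)%O.

Definition tukey_quotient {d d' : Order.disp_t}
    (P : porderType d) (Q : porderType d') : Prop :=
  exists phi : P -> Q, forall C : set P, cofinal C -> cofinal (phi @` C).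

(* [(set X)^d] is [set X] ordered by reverse inclusion; neighborhoods are not
   required to be open. *)
Definition nbhs_poset {X : topologicalType} (x : X) :
    porderType (Order.dual_display set_display) :=
  sub_type {A : (set X)^d | `[< nbhs x A >]}.

Lemma nbhs_poset_leE (X : topologicalType) (x : X) (U V : nbhs_poset x) :
  (U <= V)%O = ((val V : set X) `<=` (val U : set X)) :> Prop.
Proof. by rewrite -subsetEset. Qed.

Definition has_nbhs_base {d : Order.disp_t} (P : porderType d)
    {X : topologicalType} (x : X) : Prop :=
  tukey_quotient P (nbhs_poset x).

Definition convergent_seqs_bounded {d : Order.disp_t}
    (P : POrderedTopological.type d) : Prop :=
  forall (u : nat -> P) (p : P), u @ \oo --> p -> has_ubound (range u).

Definition accumulation_point {X : topologicalType} (u : nat -> X) (x : X) : Prop :=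
  forall O : set X, nbhs x O -> infinite_set [set n | O (u n)].

Definition pytkeev_star_network {X : topologicalType} (x : X)
    (N : set (set X)) : Prop :=
  forall (O : set X) (u : nat -> X), nbhs x O -> accumulation_point u x ->
    exists2 A : set X, N A & A `<=` O /\ infinite_set [set n | A (u n)].

(* Main.v *)
(** Let [phi] witness the Tukey quotient.  The sets [U p], the unions of
[phi q] over [q >= p], form a monotone neighborhood base at [x].  The network
consists of the intersections of [U q] over [q] in [B], for [B] in a countable
basis of [P].  If it failed for a neighborhood containing [U p] and a sequence
[u], then every basic [B] containing [p] would give a set containing only
finitely many [u n]; so one could choose [q n] converging to [p] with [u n]
outside [U (q n)] for almost all [n].  For an upper bound [r] of the [q n], the
neighborhood [U r] would then contain only finitely many [u n]. *)
Require Import Defs.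
From HB Require Import structures.
From mathcomp Require Import all_boot all_order.
From mathcomp Require Import all_classical all_reals all_analysis.

Set Implicit Arguments.
Unset Strict Implicit.
Unset Printing Implicit Defensive.

Import Order.TTheory.
Local Open Scope classical_set_scope.

(** If no [U p] fits in [O], the [q] with [V q] not contained in [O] are cofinal; their images are
    then cofinal, so some such [V q] lies in [O], a contradiction. *)
Lemma has_nbhs_base_antitone (d : Order.disp_t) (P : porderType d)
    (X : topologicalType) (x : X) : has_nbhs_base P x ->
  exists U : P -> set X, [/\ forall p, nbhs x (U p),
    forall p q, (p <= q)%O -> U q `<=` U p &
    forall O, nbhs x O -> exists p, U p `<=` O].
Proof.
case=> phi phiP; pose V p : set X := val (phi p).
exists (fun p => \bigcup_(q in [set q | (p <= q)%O]) V q); split.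
- move=> p; apply: filterS (bigcup_sup (i := p) _) _; first exact: lexx.
  exact/asboolP/(valP (phi p)).
- by move=> p q pq y [r /= qr Vr]; exists r => //=; exact: le_trans qr.
move=> O Ox; apply: contrapT => noU.
have Ox' : `[< nbhs x O >] by apply/asboolP.
pose o : nbhs_poset x := Sub (O : (set X)^d) Ox'.
have [|_ [q qO <-]] := phiP [set q | ~ (V q `<=` O)] _ o.
  move=> p; apply: contrapT => noq; apply: noU; exists p => y [q /= pq Vq].
  by apply: contrapT => Oy; apply: noq; exists q => //= /(_ _ Vq).
by rewrite nbhs_poset_leE.
Qed.

Lemma decreasing_nbhs_base (P : topologicalType) (B : set (set P)) (p : P) :
    countable B -> basis B ->
  exists W : nat -> set P, [/\ forall k, nbhs p (W k),
    forall k l, (k <= l)%N -> W l `<=` W k &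
    forall O, nbhs p O -> exists k, W k `<=` O].
Proof.
move=> /pfcard_geP[B0|[e]] [Bo Bp].
  by have [b []] := Bp p setT filterT; rewrite B0.
exists (fun k => \bigcap_(i in [set i | (i < k)%N /\ e i p]) e i); split.
- move=> k; elim: k => [|k IH]; first by apply: filterS filterT => y _ i [].
  have [ekp|ekp] := pselect (e k p).
    have ek : nbhs p (e k) by apply: open_nbhs_nbhs; split=> //; exact/Bo/funS.
    apply: filterS (filterI IH ek) => y [yW yk] i [].
    rewrite ltnS leq_eqVlt => /predU1P[->//|ik eip]; exact: yW.
  apply: filterS IH => y yW i []; rewrite ltnS leq_eqVlt => /predU1P[->//|ik eip].
  exact: yW.
- by move=> k l kl y yW i [ik eip]; apply: yW; split=> //; exact: leq_trans kl.
move=> O /Bp[b [Bb bp] bO].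
have [k _ ekb] := 'surj_e Bb.
(* The index [k.+1] is the first one whose intersection includes [e k]. *)
by exists k.+1 => y yW; apply: bO; rewrite -ekb; apply: yW; rewrite /= ekb.
Qed.

Lemma finite_set_near_infty (A : set nat) :
  finite_set A -> \forall n \near \oo, ~ A n.
Proof.
move=> /finite_seqP[s ->]; elim: s => [|a s IH]; first exact: nearW.
apply: filterS2 (nbhs_infty_gt a) IH => n an ns /=.
by rewrite inE => /predU1P[na|//]; rewrite na ltnn in an.
Qed.

Theorem theorem4p2 (d : Order.disp_t) (P : POrderedTopological.type d)
    (P_tychonoff : tychonoff_space P) (P_directed : directed P)
    (P_second_countable : @second_countable P)
    (P_bounded : convergent_seqs_bounded P)
    (X : topologicalType) (X_tychonoff : tychonoff_space X) (x : X)
    (X_base : has_nbhs_base P x) :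
  exists2 N : set (set X), countable N & pytkeev_star_network x N.
Proof.
have [U [Ux Umono Ubase]] := has_nbhs_base_antitone X_base.
have [B Bcount Bbasis] := P_second_countable.
pose N (A : set P) : set X := \bigcap_(q in A) U q.
exists (N @` B).
  exact: card_le_trans (card_image_le _ _) Bcount.
move=> O u Ox uacc.
have [p UpO] := Ubase O Ox.
apply: contrapT => noN.
pose F (A : set P) := [set n | N A (u n)].
(* Passing from [A] to a basic [b] inside it enlarges [N A], while [p] in [b] keeps [N b] inside
   [U p]. *)
have Ffin A : nbhs p A -> finite_set (F A).
  move=> /(Bbasis.2 p)[b [Bb bp] bA]; apply: contrapT => Finf; apply: noN.
  exists (N b); first by exists b.
  split; first by move=> y /(_ p bp)/UpO.
  by apply: contra_not Finf; apply: sub_finite_set => n NA q /bA/NA.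
have [W [Wp Wmono Wbase]] := decreasing_nbhs_base p Bcount Bbasis.
have witness n A : ~ F A n -> exists2 q, A q & ~ U q (u n).
  move=> nF; apply: contrapT => noq; apply: nF => q Aq.
  by apply: contrapT => nU; apply: noq; exists q.
(* [q n] is taken in [W m] for the largest [m <= n] with [u n] outside [N (W m)], and is [p] if
   there is none. The induction is on the bound for [k], with [n] fixed. *)
have /choice[q qP] n : exists q, (forall k, (k <= n)%N -> ~ F (W k) n -> W k q) /\
    (~ F (W 0) n -> ~ U q (u n)).
  move: {1}n => m; elim: m => [|m [q [qW qU]]].
    have [F0|/[dup] F0 /witness[q qW qU]] := pselect (F (W 0) n).
      by exists p; split=> // k _ _; exact: nbhs_singleton.
    by exists q; split=> [k|_ //]; rewrite leqn0 => /eqP->.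
  have [Fm|/witness[r rW rU]] := pselect (F (W m.+1) n).
    by exists q; split=> // k; rewrite leq_eqVlt => /predU1P[->//|]; exact: qW.
  by exists r; split=> [k km _|_ //]; first exact: Wmono rW.
have qp : q @ \oo --> p.
  move=> A /Wbase[k WkA]; have Fk := finite_set_near_infty (Ffin _ (Wp k)).
  apply: filterS2 (nbhs_infty_ge k) Fk => n kn nFk.
  exact/WkA/((qP n).1 k kn nFk).
have [r rub] := P_bounded q p qp.
(* The default [p] was used only for [n] in the finite set [F (W 0)]; for all other [n], [U r]
   misses [u n]. *)
apply: (uacc (U r) (Ux r)); apply: sub_finite_set (Ffin _ (Wp 0)) => n Ur.
apply: contrapT => /(qP n).2; apply.
by apply: Umono Ur; apply: rub; exists n.
Qed.
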